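(* Let $X_n(\theta)$, for $n\in\mathbb{N}_0$ and a fixed $\theta\in\{0,1\}^{\mathbb{N}}$, be the depth of the first free node along the path $\theta$ in the random digital search tree $T_n$ built from $n$ independent random variables uniformly distributed on the unit interval. For $0\le\eta\le 1$ let $Q_\eta$ be the distribution of $\lfloor -\log_2 S_\infty+\eta\rfloor$, where $S_\infty=\sum_{k=0}^\infty 2^{-k}Y_{\infty,k}$ with $(Y_{\infty,k})_{k\in\mathbb{N}_0}$ independent and all exponentially distributed with parameter $2$. If the sequence $(n(m))_{m\in\mathbb{N}}\subset\mathbb{N}$ is such that $n(m)\to\infty$ and $\{\log_2 n(m)\}\to\eta$ as $m\to\infty$, for some $\eta\in[0,1]$, then $$X_{n(m)}(\theta)-\lfloor\log_2 n(m)\rfloor\to Q_\eta\quad\text{in distribution as } m\to\infty.$$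
   Context: $\mathbb{N}=\{1,2,\dots\}$, $\mathbb{N}_0=\{0,1,2,\dots\}$. Nodes of a binary tree are finite strings of 0's and 1's (the empty string is the root; 0 means move left, 1 means move right); the depth of a node is the length of the string. Let $(U_n)_{n\in\mathbb{N}}$ be independent random variables, each uniformly distributed on the unit interval. The digital search tree (DST) algorithm produces random trees (finite sets of occupied nodes) $T_0,T_1,T_2,\dots$ as follows: $T_0$ is empty; given $T_n$, the value $U_{n+1}$ is inserted by traveling from the root in the directions given by the successive bits of the binary expansion of $U_{n+1}$ until a node not in $T_n$ is found, and $T_{n+1}$ is $T_n$ together with this node (in particular $U_1$ is put into the root). For $\theta=(\theta_1,\theta_2,\dots)\in\{0,1\}^{\mathbb{N}}$, $X_n(\theta):=\min\{k\in\mathbb{N}_0: (\theta_1,\dots,\theta_k)\notin T_n\}$, so $X_0(\theta)=0$. Equivalently, $(X_n(\theta))_{n\in\mathbb{N}_0}$ is a Markov chain on $\mathbb{N}_0$ started at $0$ with transition probabilities $p_{k,k+1}=1-p_{k,k}=2^{-k}$ for all $k\in\mathbb{N}_0$. The exponential distribution with parameter $\lambda$ has mean $1/\lambda$. $\lfloor x\rfloor$ is the greatest integer $\le x$ and $\{x\}=x-\lfloor x\rfloor$. Convergence in distribution to a probability measure $\mu$ means weak convergence of the laws to $\mu$. *)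

(* Defs.v *)
From HB Require Import structures.
From mathcomp Require Import all_boot all_order all_algebra finmap.
From mathcomp Require Import all_classical all_reals all_analysis.
From mathcomp Require Import measurable_realfun.

Set Implicit Arguments.
Unset Strict Implicit.
Unset Printing Implicit Defensive.

Import Order.TTheory GRing.Theory Num.Theory.
Import numFieldNormedType.Exports.

Local Open Scope classical_set_scope.
Local Open Scope ring_scope.

Section probability_notions.
Context d (T : measurableType d) (R : realType) (P : probability T R).

Definition mutually_independent (I : choiceType) d' (T' : measurableType d')
    (X : I -> {RV P >-> T'}) : Prop :=
  forall (J : {fset I}) (A : I -> set T'),
    (forall i, i \in J -> measurable (A i)) ->
    P (\bigcap_(i in [set` J]) (X i @^-1` A i)) =
    (\prod_(i <- J) P (X i @^-1` A i))%E.

Definition has_law d' (T' : measurableType d')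
    (X : {RV P >-> T'}) (mu : set T' -> \bar R) : Prop :=
  forall A, measurable A -> distribution P X A = mu A.

End probability_notions.

Definition weakly_converges (R : realType)
    (mu : nat -> probability R R) (nu : probability R R) : Prop :=
  forall f : R -> R, continuous f -> bounded_fun f ->
    (\int[mu m]_x (f x)%:E)%E @[m --> \oo] --> (\int[nu]_x (f x)%:E)%E.

Section digital_search_tree.

(* A node is the string of the directions leading to it; an infinite path
   theta_1 theta_2 ... is the function b with b k = theta_(k+1), whose prefix
   of length k is mkseq b k. *)
Implicit Types (t : {fset seq bool}) (b : nat -> bool).

Lemma exists_free t b : exists k, mkseq b k \notin t.
Proof.
pose N := (\max_(s <- t) size s).+1.
exists N; apply/negP => Nt.
have : (size (mkseq b N) <= \max_(s <- t) size s)%N by exact: leq_bigmax_seq.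
by rewrite size_mkseq ltnn.
Qed.

Definition first_free t b : nat := ex_minn (exists_free t b).

Definition dst_insert t b : {fset seq bool} :=
  (mkseq b (first_free t b) |` t)%fset.

(* b i is the bit string of the (i+1)-st inserted value. *)
Fixpoint dst (b : nat -> nat -> bool) (n : nat) : {fset seq bool} :=
  if n is m.+1 then dst_insert (dst b m) (b m) else fset0.

End digital_search_tree.

(* binary_digit x k is the coefficient of 2^-(k+1) in the binary expansion of
   x in [0, 1[; for dyadic x this is the expansion ending in zeros. *)
Definition binary_digit (R : realType) (x : R) (k : nat) : bool :=
  odd `|Num.floor (2 ^+ k.+1 * x)|%N.

Definition log2 (R : realType) (x : R) : R := ln x / ln 2.

Definition frac_part (R : realType) (x : R) : R := x - (Num.floor x)%:~R.

Section measurability.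
Context d (T : measurableType d).

Let dmeas (V : Type) (f : T -> V) := forall A : set V, measurable (f @^-1` A).

Let dmeas_bind (V W : Type) (c : countable [set: V]) (f : T -> V) (g : V -> T -> W) :
  dmeas f -> (forall v, dmeas (g v)) -> dmeas (fun x => g (f x) x).
Proof.
move=> mf mg A.
rewrite (_ : _ @^-1` A = \bigcup_v (f @^-1` [set v] `&` g v @^-1` A)).
  by apply: countable_bigcupT_measurable => // v; apply: measurableI; [exact: mf|exact: mg].
apply/seteqP; split => [x Ax|x [v _ [/= <-]]//].
by exists (f x).
Qed.

Let dmeas_cst (V : Type) (v : V) : dmeas (fun=> v).
Proof. by move=> A; rewrite preimage_cst; case: ifP. Qed.

Let dmeas_comp (V W : Type) (f : T -> V) (g : V -> W) :
  dmeas f -> dmeas (g \o f).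
Proof. by move=> mf A; rewrite comp_preimage; exact: mf. Qed.

Let dmeas_mkseq (b : T -> nat -> bool) k : (forall k, dmeas (b ^~ k)) ->
  dmeas (fun x => mkseq (b x) k).
Proof.
move=> mb; elim: k => [|k IH]; first exact: dmeas_cst.
rewrite (_ : (fun x => _) = (fun x => rcons (mkseq (b x) k) (b x k))); last first.
  by apply/funext => x; rewrite mkseqS.
apply: (@dmeas_bind _ _ _ _ (fun s x => rcons s (b x k))) => // v.
exact: (dmeas_comp (rcons v) (mb k)).
Qed.

Let dmeas_first_free t (b : T -> nat -> bool) : (forall k, dmeas (b ^~ k)) ->
  dmeas (fun x => first_free t (b x)).
Proof.
move=> mb A.
rewrite (_ : _ @^-1` A = \bigcup_(k in A)
   ((fun x => mkseq (b x) k) @^-1` [set s | s \notin t] `&`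
    \bigcap_(j in `I_k) ((fun x => mkseq (b x) j) @^-1` [set s | s \in t]))).
  apply: bigcup_measurable => k _; apply: measurableI; first exact: dmeas_mkseq.
  by apply: bigcap_measurableType => j _; exact: dmeas_mkseq.
apply/seteqP; split => x /=; rewrite /first_free; case: ex_minnP => k kt kmin.
- move=> Ak; exists k => //; split => //= j /= jk.
  by apply: contraLR jk => /kmin; rewrite -leqNgt.
- move=> [j Aj [/= jt jmin]]; suff -> : k = j by [].
  apply/eqP; rewrite eqn_leq kmin//= leqNgt; apply/negP => /jmin/=.
  exact/negP.
Qed.

Let dmeas_dst (b : T -> nat -> nat -> bool) n : (forall i k, dmeas (fun x => b x i k)) ->
  dmeas (fun x => dst (b x) n).
Proof.
move=> mb; elim: n => [|n IH]; first exact: dmeas_cst.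
apply: (@dmeas_bind _ _ _ _ (fun t x => dst_insert t (b x n))) => // t.
apply: (@dmeas_bind _ _ _ (fun x => first_free t (b x n))
  (fun k x => (mkseq (b x n) k |` t)%fset)) => //.
  by apply: dmeas_first_free => k; exact: mb.
move=> k; apply: (dmeas_comp (fun s => (s |` t)%fset)).
by apply: dmeas_mkseq => j; exact: mb.
Qed.

Lemma measurable_preimage_floor (R : realType) (f : T -> R) (A : set int) :
  measurable_fun setT f -> measurable ((fun x => Num.floor (f x)) @^-1` A).
Proof.
move=> mf.
rewrite (_ : _ @^-1` A = \bigcup_(k in A) (f @^-1` `[k%:~R, (k + 1)%:~R[)).
  rewrite bigcup_mkcond.
  apply: countable_bigcupT_measurable => // k; case: ifP => // _.
  by rewrite -[X in measurable X]setTI; apply: mf => //; exact: measurable_itv.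
apply/seteqP; split => [x Ax|x [k Ak /=]].
  by exists (Num.floor (f x)) => //=; rewrite in_itv/= floor_itv.
by rewrite in_itv/= => /floor_def ->.
Qed.

Lemma measurable_first_free (R : realType) (U : nat -> T -> R)
    (theta : nat -> bool) (n : nat) :
  (forall i, measurable_fun setT (U i)) ->
  measurable_fun setT (fun x =>
    first_free (dst (fun i => binary_digit (U i x)) n) theta).
Proof.
move=> mU _ A _; rewrite setTI.
apply: (dmeas_comp (fun t => first_free t theta)).
apply: dmeas_dst => i k B.
apply: (@measurable_preimage_floor _ _ [set z | B (odd `|z|%N)]).
exact: measurable_funM.
Qed.

Lemma limn_esup_einf_cvg (R : realType) (u : nat -> R) :
  cvgn u <-> limn_einf (EFin \o u) = limn_esup (EFin \o u) /\
             limn_esup (EFin \o u) \is a fin_num.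
Proof.
split=> [/cvg_ex[l ul]|[eu fu]].
  have ule : (EFin \o u) @ \oo --> l%:E by apply: cvg_EFin => //; exact: nearW.
  by rewrite !(cvg_limn_einf_sup ule).
have : (EFin \o u) @ \oo --> limn_esup (EFin \o u).
  apply: (@squeeze_cvge _ _ _ _ (einfs (EFin \o u)) _ (esups (EFin \o u))).
  - apply: nearW => k; rewrite ereal_inf_lbound ?ereal_sup_ubound//.
    + by exists k => /=.
    + by exists k => /=.
  - by rewrite -eu limn_einf_lim; exact: is_cvg_einfs.
  - by rewrite limn_esup_lim; exact: is_cvg_esups.
rewrite -(fineK fu) => /fine_cvgP[_ ul].
by apply/cvg_ex; eexists; exact: ul.
Qed.

Lemma measurable_limn (R : realType) (h : nat -> T -> R) :
  (forall k, measurable_fun setT (h k)) ->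
  measurable_fun setT (fun x => limn (h ^~ x)).
Proof.
move=> mh.
pose u x := EFin \o (h ^~ x).
have mes : measurable_fun setT (fun x => limn_esup (u x)).
  by apply: measurable_fun_limn_esup => k; exact/measurable_EFinP.
have mei : measurable_fun setT (fun x => limn_einf (u x)).
  rewrite /limn_einf; apply: measurableT_comp => //.
  apply: measurable_fun_limn_esup => k.
  by apply: measurableT_comp => //; exact/measurable_EFinP.
pose C := [set x | cvgn (h ^~ x)].
have mC : measurable C.
  rewrite (_ : C = (setT `&` [set x | limn_einf (u x) = limn_esup (u x)]) `&`
      (fun x => limn_esup (u x)) @^-1` [set y | y \is a fin_num]); last first.
    apply/seteqP; split => x /=.
      by move=> /limn_esup_einf_cvg[? ?].
    by move=> [[_ ?] ?]; exact/limn_esup_einf_cvg.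
  apply: measurableI; first exact: measurable_eqe.
  rewrite -[X in measurable X]setTI.
  exact: (emeasurable_fin_num measurableT mes).
rewrite -(setUv C); apply/measurable_funU => //; first exact: measurableC.
split.
  apply: (@measurable_fun_cvg _ _ _ _ h) => // k.
  exact: measurable_funTS.
apply: (eq_measurable_fun (cst point)) => // x.
by rewrite inE => /= /dvgP ->.
Qed.

End measurability.

Section random_variables.
Context d (T : measurableType d) (R : realType) (P : probability T R).

Section free_depth.
(* U i is the (i+1)-st inserted value U_(i+1). *)
Variables (U : nat -> {RV P >-> R}) (theta : nat -> bool) (n : nat).

Definition free_depth (x : T) : nat :=
  first_free (dst (fun i => binary_digit (U i x)) n) theta.

Let measurable_free_depth : measurable_fun setT free_depth.
Proof. by apply: measurable_first_free => i. Qed.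

HB.instance Definition _ :=
  isMeasurableFun.Build _ _ _ _ free_depth measurable_free_depth.

Definition centered_free_depth (x : T) : R :=
  (free_depth x)%:R - (Num.floor (log2 (n%:R : R)))%:~R.

Let measurable_centered_free_depth : measurable_fun setT centered_free_depth.
Proof.
apply: measurable_funB => //.
exact: (measurableT_comp (f := fun k : nat => k%:R : R)).
Qed.

HB.instance Definition _ := isMeasurableFun.Build _ _ _ _
  centered_free_depth measurable_centered_free_depth.

End free_depth.

Section limit_variable.
Variable Y : nat -> {RV P >-> R}.

(* limn is a junk value on the null set where the series diverges. *)
Definition S_infty (x : T) : R := limn (series (fun k => 2 ^- k * Y k x)).

Let measurable_S_infty : measurable_fun setT S_infty.
Proof.
apply: (@measurable_limn _ _ _ (fun k x => series (fun k => 2 ^- k * Y k x) k)).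
move=> k; apply: measurable_sum => i.
exact: measurable_funM.
Qed.

HB.instance Definition _ :=
  isMeasurableFun.Build _ _ _ _ S_infty measurable_S_infty.

Variable eta : R.

Definition limit_depth (x : T) : R :=
  (Num.floor (- log2 (S_infty x) + eta))%:~R.

Let measurable_limit_depth : measurable_fun setT limit_depth.
Proof.
move=> _ A _; rewrite setTI.
apply: (@measurable_preimage_floor _ _ _ _ [set z | A z%:~R]).
apply: measurable_funD => //; apply: measurableT_comp => //.
by apply: measurable_funM => //; exact: measurableT_comp.
Qed.

HB.instance Definition _ :=
  isMeasurableFun.Build _ _ _ _ limit_depth measurable_limit_depth.

End limit_variable.

End random_variables.

(* Main.v *)
Require Import Defs.
From mathcomp Require Import all_boot all_order all_algebra finmap.
From mathcomp Require Import all_classical all_reals all_analysis.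
From mathcomp Require Import measurable_realfun zify ring lra.

Import Order.TTheory GRing.Theory Num.Theory.
Import numFieldNormedType.Exports.

Local Open Scope classical_set_scope.
Local Open Scope ring_scope.

(** The depth of the first free node along a fixed path is a pure birth chain:
    at depth [k] it moves to [k + 1] exactly when the inserted value has the
    first [k] directions of the path as its leading digits, an event of
    probability [2 ^- k] that is independent of the past.  Hence the probability
    [reach n k] that the depth is at least [k] after [n] insertions satisfies a
    two-term recursion ([prob_le_free_depth]).

    For [K] levels, [reach n K] is also [P (tau_K <= n)], where [tau_K] is a sum
    of independent geometric holding times with success probabilities [2 ^- j],
    [j < K].  A geometric variable is the integer part of an exponential one plus
    one, so the [tau_K] can all be built from the variables [Y_l] of the limit,
    provided that the level [j] uses [Y_(K - 1 - j)] ([hitting_time],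
    [prob_hitting_time_le]).  With this coupling, the term of [tau_K / 2 ^ K] that
    comes from [Y_l] is [2 ^- l * Y_l] up to [2 ^- K * max(1, 2 Y_l)], so that
    [tau_K / 2 ^ K] converges almost surely to [S_infty] ([cvg_hitting_time],
    [ae_cvg_hitting_time]).

    The recursion also gives [reach (n + 1) (k + 1) - reach n (k + 1) <= 2 ^- k].
    At the scale [2 ^ k] this is a Lipschitz bound that survives in the limit:
    [S_infty] has no atom ([S_infty_atomless]).  Almost sure convergence therefore
    yields [P (tau_K <= n) -> P (S_infty <= x)] whenever [n / 2 ^ K -> x]
    ([cvg_reach]).  For [K = floor (log2 n) + j] the ratio [n / 2 ^ K] is
    [2 ^ (frac_part (log2 n) - j)] and tends to [2 ^ (eta - j)], and
    [S_infty <= 2 ^ (eta - j)] says that the floor of [- log2 S_infty + eta] is at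
    least [j].  Thus the masses at every integer converge, and for a limit
    supported by the integers this implies weak convergence
    ([weakly_converges_mass]). *)

Set Implicit Arguments.
Unset Strict Implicit.
Unset Printing Implicit Defensive.

(** * Free nodes of a prefix-closed tree *)

Section tree.
Implicit Types (t : {fset seq bool}) (b c : nat -> bool).

Definition prefix_closed t :=
  forall b k, mkseq b k.+1 \in t -> mkseq b k \in t.

Lemma mkseq_prefix b c j k : (j <= k)%N ->
  mkseq b k = mkseq c k -> mkseq b j = mkseq c j.
Proof.
move=> jk bc; suff tk (e : nat -> bool) : take j (mkseq e k) = mkseq e j.
  by rewrite -tk bc tk.
by rewrite /mkseq -map_take take_iota (minn_idPl jk).
Qed.

Lemma mkseq_in_closed t b k : prefix_closed t ->
  (mkseq b k \in t) = (k < first_free t b)%N.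
Proof.
move=> ct; rewrite /first_free; case: ex_minnP => m mt mmin.
rewrite ltnNge; apply/idP/idP => [kt|]; last first.
  by apply: contraNT => /mmin.
apply: contra mt => mk; rewrite -(subnK mk) in kt.
by elim: (k - m)%N kt => // i IH /ct.
Qed.

(** The node above the inserted one is occupied, since the search stopped at the
    first free node. *)
Lemma prefix_closed_insert t c : prefix_closed t ->
  prefix_closed (dst_insert t c).
Proof.
move=> ct b k; rewrite !in_fset1U => /orP[/eqP e|/ct ->]; last by rewrite orbT.
have ek : first_free t c = k.+1.
  by have := congr1 size e; rewrite !size_mkseq.
apply/orP; right; rewrite (@mkseq_prefix b c _ k.+1)// ?e ?ek//.
by rewrite mkseq_in_closed// ek.
Qed.

Lemma prefix_closed_dst (b : nat -> nat -> bool) n : prefix_closed (dst b n).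
Proof.
by elim: n => [|n IH]; [move=> c k; rewrite !inE|exact: prefix_closed_insert].
Qed.

(** One insertion moves the first free node along [b] by at most one level, and
    only if the inserted string follows [b] down to that node. *)
Lemma lt_first_free_insert t c b k : prefix_closed t ->
  (k < first_free (dst_insert t c) b)%N =
  (k < first_free t b)%N ||
  (first_free t b == k) && (mkseq c k == mkseq b k).
Proof.
move=> ct; rewrite -!mkseq_in_closed//; last exact: prefix_closed_insert.
rewrite in_fset1U orbC; congr (_ || _).
(* a path that agrees with b up to level k has the same occupied prefixes *)
have ff (e e' : nat -> bool) : mkseq e k = mkseq e' k ->
    first_free t e = k -> first_free t e' = k.
  move=> ee' ek; apply/eqP; rewrite eqn_leq.
  rewrite leqNgt -mkseq_in_closed// -ee' mkseq_in_closed// ek ltnn/=.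
  case: k => // j in ee' ek *.
  rewrite -mkseq_in_closed// -(mkseq_prefix _ ee')// mkseq_in_closed//.
  by rewrite ek.
apply/eqP/andP => [e|[/eqP ek /eqP cb]]; last by rewrite (ff _ _ (esym cb)).
have ek : first_free t c = k by have := congr1 size e; rewrite !size_mkseq.
rewrite ek in e; rewrite e eqxx; split=> //; apply/eqP; exact: ff ek.
Qed.
End tree.

(** * Events independent of the variables not yet used *)

Section independent_event.
Context d (T : measurableType d) (R : realType) (P : probability T R).
Context d' (T' : measurableType d') (I : choiceType) (X : I -> {RV P >-> T'}).
Implicit Types (D : pred I) (E : set T) (p q : R).

(** [E] has probability [p] and is independent of the family of the [X i] with
    [D i].  Independence is given through products over finite families, and this
    form passes through the closure properties below.  Keeping [p] in the
    definition makes each of them compute a probability. *)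
Definition indep_event D E p : Prop :=
  measurable E /\
  forall (J : {fset I}) (A : I -> set T'),
    (forall i, i \in J -> D i) -> (forall i, i \in J -> measurable (A i)) ->
    P (E `&` \bigcap_(i in [set` J]) (X i @^-1` A i)) =
    (p * \prod_(i <- J) fine (P (X i @^-1` A i)))%:E.

Lemma indep_event_prob D E p : indep_event D E p -> P E = p%:E.
Proof.
move=> [_ /(_ fset0 (fun=> set0))]; rewrite bigcap_fset !big_seq_fset0.
by rewrite setIT mulr1; apply.
Qed.

Lemma indep_event_sub D D' E p : subpred D' D ->
  indep_event D E p -> indep_event D' E p.
Proof.
by move=> DD [mE iE]; split => // J A JD; apply: iE => i /JD; exact: DD.
Qed.

Lemma indep_eventT D : mutually_independent X -> indep_event D setT 1.
Proof.
move=> iX; split => // J A _ mA; rewrite setTI mul1r iX// -prodEFin.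
rewrite !big_seq; apply: eq_bigr => i iJ; rewrite fineK// fin_num_measure//.
by apply: measurable_funPTI; exact: mA.
Qed.

Lemma indep_event0 D : indep_event D set0 0.
Proof. by split => // J A _ mA; rewrite set0I measure0 mul0r. Qed.

Let mbigcap (J : {fset I}) (A : I -> set T') :
  (forall i, i \in J -> measurable (A i)) ->
  measurable (\bigcap_(i in [set` J]) (X i @^-1` A i)).
Proof.
move=> mA; apply: fin_bigcap_measurable => // i /= iJ.
by apply: measurable_funPTI; exact: mA.
Qed.

Lemma indep_eventU D E E' p p' : E `&` E' = set0 ->
  indep_event D E p -> indep_event D E' p' ->
  indep_event D (E `|` E') (p + p').
Proof.
move=> EE' [mE iE] [mE' iE']; split; first exact: measurableU.
move=> J A JD mA; have mJ := mbigcap mA; rewrite setIUl measureU; last first.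
- by rewrite setIACA EE' set0I.
- exact: measurableI.
- exact: measurableI.
- by rewrite [X in (X + _)%E]iE// [X in (_ + X)%E]iE'// -EFinD mulrDl.
Qed.

Lemma indep_eventD D E E' p p' : E' `<=` E ->
  indep_event D E p -> indep_event D E' p' ->
  indep_event D (E `\` E') (p - p').
Proof.
move=> EE' [mE iE] [mE' iE']; split; first exact: measurableD.
move=> J A JD mA; have mJ := mbigcap mA.
set B := \bigcap_(i in _) _ in mJ *.
have -> : (E `\` E') `&` B = (E `&` B) `\` (E' `&` B).
  by apply/seteqP; split => x /= [[? ?] ?]; split => //; tauto.
rewrite measureD; [|exact: measurableI|exact: measurableI|].
- rewrite (_ : _ `&` (E' `&` B) = E' `&` B); last first.
    by apply/setIidr => x [/EE' ? ?].
  by rewrite [X in (X - _)%E]iE// [X in (_ - X)%E]iE'// -EFinB mulrBl.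
- by rewrite -ge0_fin_numE// fin_num_measure//; exact: measurableI.
Qed.

(** Conditioning on a variable that has not been used yet multiplies the
    probability and consumes that variable. *)
Lemma indep_eventI D E p i (B : set T') q : D i -> measurable B ->
  P (X i @^-1` B) = q%:E -> indep_event D E p ->
  indep_event (fun j => D j && (j != i)) (E `&` X i @^-1` B) (p * q).
Proof.
move=> Di mB Bq [mE iE]; split.
  by apply: measurableI => //; exact: measurable_funPTI.
move=> J A JD mA.
have iJ : i \notin J by apply/negP => /JD; rewrite eqxx andbF.
pose A' j := if j == i then B else A j.
have A'J j : j \in J -> A' j = A j.
  by move=> /JD/andP[_ /negbTE ji]; rewrite /A' ji.
(* The event on [X i] is absorbed into the finite family. *)
have := iE (i |` J)%fset A'; rewrite bigcap_fsetU1 big_fsetU1//=.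
rewrite [in A' i]/A' eqxx Bq/= mulrA.
rewrite (eq_big_seq (fun j => fine (P (X j @^-1` A j)))); last first.
  by move=> j jJ; rewrite A'J.
rewrite setIA (_ : \bigcap_(j in [set` J]) X j @^-1` A' j =
                   \bigcap_(j in [set` J]) X j @^-1` A j); last first.
  by apply: eq_bigcapr => j jJ; rewrite A'J.
apply=> j; rewrite in_fset1U => /orP[/eqP ->//|jJ].
- by have /JD/andP[] := jJ.
- by rewrite /A' eqxx.
- by rewrite A'J//; exact: mA.
Qed.

End independent_event.

(** * The birth chain *)

Section reach.
Variable R : realType.

Lemma exp2N_gt0 j : 0 < 2 ^- j :> R.
Proof. by rewrite invr_gt0 exprn_gt0. Qed.

Lemma exp2N_le1 j : 2 ^- j <= 1 :> R.
Proof. by rewrite invf_le1 ?exprn_gt0// exprn_ege1// ler1n. Qed.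

Lemma exp2NS_le j : 2 ^- j.+1 <= 2^-1 :> R.
Proof. by rewrite exprS invfM ler_piMr// exp2N_le1. Qed.

(** The probability that the chain which jumps from [j] to [j + 1] with
    probability [2 ^- j] is at level [k] or above after [n] steps from [0]. *)
Fixpoint reach (n k : nat) : R :=
  if k isn't k'.+1 then 1 else
  if n isn't n'.+1 then 0 else
  (1 - 2 ^- k') * reach n' k + 2 ^- k' * reach n' k'.

Lemma reachn0 n : reach n 0 = 1. Proof. by case: n. Qed.

Lemma reachSS n k :
  reach n.+1 k.+1 = reach n k.+1 + (reach n k - reach n k.+1) * 2 ^- k.
Proof. by rewrite /=; ring. Qed.

End reach.

Section reach_bounds.
Variable R : realType.

Lemma reach_itv n k : 0 <= reach R n k <= 1.
Proof.
elim: n k => [|n IH] [|k]; rewrite ?reachn0 ?ler01 ?lexx//=.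
have /andP[a0 a1] := IH k.+1; have /andP[b0 b1] := IH k.
have := exp2N_gt0 R k; have := exp2N_le1 R k.
move: (2 ^- k) (reach R n k.+1) (reach R n k) a0 a1 b0 b1 => p a b; nra.
Qed.

(** The chain enters level [k + 1] at a given step with probability at most
    [2 ^- k]; this bound is what rules out atoms of the limit. *)
Lemma reach_increment n m k :
  reach R (m + n) k.+1 - reach R n k.+1 <= m%:R * 2 ^- k.
Proof.
elim: m => [|m IH]; first by rewrite subrr mul0r.
rewrite addSn reachSS -[m.+1%:R]natr1 [(_ + 1) * _]mulrDl mul1r.
have /andP[a0 a1] := reach_itv (m + n) k.+1.
have /andP[b0 b1] := reach_itv (m + n) k.
have : (reach R (m + n) k - reach R (m + n) k.+1) * 2 ^- k <= 2 ^- k.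
  by rewrite ler_piMl// ?invr_ge0 ?exprn_ge0//; lra.
lra.
Qed.

End reach_bounds.

(** * Binary digits of a uniform variable *)

Section uniform_digits.
Variable R : realType.
Implicit Types (theta : nat -> bool) (u : R).

Definition cylinder theta k : set R :=
  [set u | mkseq (binary_digit u) k = mkseq theta k].

Lemma measurable_cylinder theta k : measurable (cylinder theta k).
Proof.
elim: k => [|k IH].
  by rewrite /cylinder (_ : [set _ | _] = setT)//; apply/seteqP; split.
rewrite (_ : cylinder _ _ = cylinder theta k `&`
    [set u | binary_digit u k = theta k]); last first.
  apply/seteqP; split => u; rewrite /cylinder /= !mkseqS.
    by move/eqP; rewrite eqseq_rcons => /andP[/eqP ? /eqP ?].
  by move=> [-> ->].
apply: measurableI => //.
apply: (@measurable_preimage_floor _ _ _ (fun u => 2 ^+ k.+1 * u)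
  [set z | odd `|z|%N = theta k]).
exact: measurable_funM.
Qed.

(** The integer whose binary expansion is given by the first [k] directions, most
    significant digit first. *)
Fixpoint prefix_value theta k : nat :=
  if k is k'.+1 then ((prefix_value theta k').*2 + theta k')%N else 0%N.

Lemma lt_prefix_value theta k : (prefix_value theta k < 2 ^ k)%N.
Proof.
elim: k => // k IH /=; rewrite expnS mul2n.
apply: (@leq_trans (prefix_value theta k).+1.*2); last by rewrite leq_double.
by rewrite doubleS ltnS; case: (theta k); rewrite ?addn1 ?addn0.
Qed.

Lemma half_truncn2 (x : R) : 0 <= x ->
  (Num.truncn (2 * x))./2 = Num.truncn x.
Proof.
move=> x0; apply/eqP; rewrite eqn_leq; apply/andP; split.
  rewrite truncn_ge_nat//.
  have : (Num.truncn (2 * x))%:R <= 2 * x by rewrite truncn_le mulr_ge0.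
  rewrite -[in X in X -> _](odd_double_half (Num.truncn (2 * x))) natrD -muln2 natrM.
  have : 0 <= (odd (Num.truncn (2 * x)))%:R :> R by [].
  set o := (odd _)%:R; set h := (_./2)%:R; move=> o0 le2.
  lra.
rewrite geq_half_double truncn_ge_nat ?mulr_ge0// -muln2 natrM.
by rewrite mulrC ler_pM2l// truncn_le.
Qed.

Lemma binary_digitE u k : 0 <= u ->
  binary_digit u k = odd (Num.truncn (2 ^+ k.+1 * u)).
Proof. by move=> u0; rewrite /binary_digit truncn_floor mulr_ge0. Qed.

(** The first [k] digits of [u] are those of the integer part of [2 ^ k * u]. *)
Lemma cylinder_truncn theta k u : 0 <= u < 1 ->
  cylinder theta k u <-> Num.truncn (2 ^+ k * u) = prefix_value theta k.
Proof.
move=> /andP[u0 u1]; elim: k => [|k [IH1 IH2]].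
  rewrite /cylinder/= mul1r; split => // _.
  by apply/eqP; rewrite -leqn0 -ltnS truncn_lt_nat.
have h : (Num.truncn (2 ^+ k.+1 * u))./2 = Num.truncn (2 ^+ k * u).
  by rewrite exprS -mulrA half_truncn2// mulr_ge0.
rewrite /cylinder /= !mkseqS binary_digitE//; split.
  move/eqP; rewrite eqseq_rcons => /andP[/eqP /IH1 e /eqP o].
  by rewrite -(odd_double_half (Num.truncn _)) h e o addnC.
move=> e; rewrite e oddD odd_double/= oddb; congr rcons; apply: IH2.
by rewrite -h e addnC half_bit_double.
Qed.

Lemma uniform_prob_itv (x y : R) : 0 <= x -> x <= y -> y <= 1 ->
  uniform_prob (@ltr01 R) `[x, y[ = (y - x)%:E.
Proof.
move=> x0 xy y1; rewrite /uniform_prob.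
rewrite (eq_integral (fun=> 1%:E)); last first.
  move=> u; rewrite inE/= in_itv/= /uniform_pdf => /andP[xu uy].
  by rewrite (le_trans x0 xu) (le_trans (ltW uy) y1) subr0 invr1.
rewrite integral_cst//= mul1e lebesgue_measure_itv/= lte_fin.
by case: ltgtP xy => // -> _; rewrite subrr.
Qed.

(** Inside the unit interval a cylinder is a dyadic interval of length [2 ^- k].
    Outside it, [binary_digit] is not controlled, but that part is null. *)
Lemma uniform_prob_cylinder theta k :
  uniform_prob (@ltr01 R) (cylinder theta k) = (2 ^- k)%:E.
Proof.
have mC := measurable_cylinder theta k.
have mI : measurable (`[0, 1[ : set R) by exact: measurable_itv.
have I1 : uniform_prob (@ltr01 R) `[0, 1[ = 1%E by rewrite uniform_prob_itv// subr0.
have I0 : uniform_prob (@ltr01 R) (~` `[0, 1[) = 0%E.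
  by rewrite probability_setC// [X in (1 - X)%E]I1 subee.
have k0 : 0 < 2 ^+ k :> R by rewrite exprn_gt0.
have q1 : (prefix_value theta k).+1%:R <= 2 ^+ k :> R.
  by rewrite -natrX ler_nat lt_prefix_value.
have -> : (cylinder theta k) = (cylinder theta k `&` `[0, 1[) `|` (cylinder theta k `\` `[0, 1[).
  by rewrite setUIDK.
have mCI : measurable (cylinder theta k `&` `[0, 1[) by exact: measurableI.
have mCD : measurable (cylinder theta k `\` `[0, 1[) by exact: measurableD.
have CD0 : uniform_prob (@ltr01 R) (cylinder theta k `\` `[0, 1[) = 0%E.
  by apply: (@subset_measure0 _ _ _ (uniform_prob (@ltr01 R)) _ _ mCD (measurableC mI)) => // x [].
rewrite [LHS]measureU0//.
rewrite (_ : _ `&` _ = `[(prefix_value theta k)%:R / 2 ^+ k,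
                         (prefix_value theta k).+1%:R / 2 ^+ k[%classic).
  rewrite [LHS]uniform_prob_itv.
  - by rewrite -mulrBl -natr1 addrAC subrr add0r mul1r.
  - by rewrite divr_ge0// ltW.
  - by rewrite ler_pM2r ?invr_gt0// ler_nat.
  - by rewrite ler_pdivrMr// mul1r.
apply/seteqP; split => u /=; rewrite !in_itv/=.
  move=> [Cu u01]; have u0 : 0 <= u by case/andP: u01.
  have /esym e := (cylinder_truncn theta k u01).1 Cu.
  rewrite ler_pdivrMr// ltr_pdivlMr// e mulrC truncn_le mulr_ge0 ?(ltW k0)//=.
  by rewrite -truncn_le_nat.
move=> /andP[qu uq].
have u0 : 0 <= u by apply: le_trans qu; rewrite divr_ge0// ltW.
have u01 : 0 <= u < 1.
  by rewrite u0/= (lt_le_trans uq)// ler_pdivrMr// mul1r.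
split => //; apply/cylinder_truncn => //; apply/eqP; rewrite eqn_leq.
rewrite truncn_le_nat truncn_ge_nat; last by rewrite mulr_ge0// ltW.
by rewrite mulrC -ltr_pdivlMr// uq -ler_pdivrMr.
Qed.
End uniform_digits.

(** * The law of the depth of the first free node *)

Section free_depth_law.
Context d (T : measurableType d) (R : realType) (P : probability T R).
Variables (U : nat -> {RV P >-> R}) (theta : nat -> bool).
Hypothesis iU : mutually_independent U.
Hypothesis lawU : forall i, has_law (U i) (uniform_prob (@ltr01 R)).

(** The depth after [n] insertions uses the variables [U i] with [i < n] only.
    It is at least [k + 1] after one more insertion if it was so already, or if it
    was exactly [k] and [U n] falls in the cylinder of level [k]. *)
Lemma indep_event_free_depth n k :
  indep_event U (fun i => n <= i)%N
    [set x | (k <= free_depth U theta n x)%N] (reach R n k).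
Proof.
elim: n k => [|n IH] [|k].
- by rewrite reachn0 (_ : [set _ | _] = setT); [exact: indep_eventT|exact/seteqP].
- rewrite (_ : [set _ | _] = set0); first exact: indep_event0.
  apply/seteqP; split => // x /=; rewrite /free_depth/= /first_free.
  by case: ex_minnP => m _ /(_ 0%N); rewrite inE leqn0 => /(_ isT)/eqP ->.
- by rewrite reachn0 (_ : [set _ | _] = setT); [exact: indep_eventT|exact/seteqP].
pose E j := [set x | (j <= free_depth U theta n x)%N].
rewrite (_ : [set _ | _] =
    E k.+1 `|` (E k `\` E k.+1) `&` (U n @^-1` cylinder theta k)); last first.
  apply/seteqP; split => x; rewrite /E/= /free_depth/=
    lt_first_free_insert//; try exact: prefix_closed_dst.
    case/orP => [->|/andP[/eqP <- /eqP ?]]; [by left|right].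
    by rewrite leqnn ltnn.
  case=> [->//|[[kf /negP fk] Ux]]; apply/orP; right; rewrite Ux eqxx andbT.
  by rewrite eqn_leq kf leqNgt fk.
rewrite reachSS; apply: indep_eventU.
- by apply/seteqP; split => // x [? [[]]].
- by apply: indep_event_sub (IH _) => i /ltnW.
- have -> : (fun i => n < i)%N = (fun i => (n <= i) && (i != n))%N.
    by apply/funext => i; rewrite ltn_neqAle andbC eq_sym.
  apply: indep_eventI => //.
  + exact: measurable_cylinder.
  + rewrite -[LHS]/(distribution P (U n) _) lawU ?uniform_prob_cylinder//.
    exact: measurable_cylinder.
  + apply: indep_eventD; [|exact: IH|exact: IH].
    by move=> x; apply: ltnW.
Qed.

Lemma prob_le_free_depth n k :
  P [set x | (k <= free_depth U theta n x)%N] = (reach R n k)%:E.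
Proof. exact: indep_event_prob (indep_event_free_depth n k). Qed.

End free_depth_law.

(** * Geometric holding times from exponential variables *)

Section exponential.
Variable R : realType.

(** Tails rather than initial intervals: memorylessness turns them into powers. *)
Lemma exponential_prob_itvy (rate a : R) : 0 < rate -> 0 <= a ->
  exponential_prob rate `[a, +oo[ = (expR (- rate * a))%:E.
Proof.
move=> rate0 a0.
have cF : continuous (fun z : R^o => expR (- rate * z)).
  move=> z; apply: continuous_comp; last exact: continuous_expR.
  by apply: continuousM => //; apply: (@continuousN _ R^o); exact: cst_continuous.
rewrite /exponential_prob (@ge0_continuous_FTC2y _ _
  (fun x => - (expR (- rate * x))) a 0).
- by rewrite sub0e -EFinN opprK.
- by move=> x _; apply: exponential_pdf_ge0; exact: ltW.
- apply: (@continuous_subspaceW R^o _ _ [set` `[0, +oo[%R]).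
    by move=> x/=; rewrite !in_itv/= !andbT; exact: le_trans.
  exact: within_continuous_exponential_pdf.
- rewrite -oppr0; apply: cvgN.
  rewrite (_ : (fun x => expR (- rate * x)) =
               (fun z => expR (- z)) \o (fun z => rate * z)); last first.
    by apply: eq_fun => x; rewrite mulNr.
  apply: (@cvg_comp _ _ _ _ _ _ (pinfty_nbhs R)); last exact: cvgr_expR.
  exact: gt0_cvgMry.
- by move=> x _; exact: ex_derive.
- by apply: cvgN; apply/cvg_at_right_filter; exact: cF.
- move=> x; rewrite in_itv/= andbT => ax; apply: derive1_exponential_pdf.
  by rewrite in_itv/= andbT (le_lt_trans a0).
Qed.

End exponential.

Section holding_times.
Variable R : realType.

(** The rate at which an exponential variable exceeds [1] with the probability
    [1 - 2 ^- j] of staying at level [j].  At [j = 0] the rate should be infinite; [ln 0 = 0] and division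
    by zero give the holding time [1], which is the correct value. *)
Definition jump_rate (j : nat) : R := - ln (1 - 2 ^- j).

(** [2 * y] is standard exponential when [y] is exponential with parameter [2]. *)
Definition holding_time (j : nat) (y : R) : nat :=
  (Num.truncn (2 * y / jump_rate j)).+1.

Lemma jump_rate0 : jump_rate 0 = 0.
Proof. by rewrite /jump_rate expr0 invr1 subrr ln0// oppr0. Qed.

Lemma jump_rate_ge j : 2 ^- j.+1 <= jump_rate j.+1.
Proof.
rewrite /jump_rate lerNr le_ln1Dx// ltrN2.
by rewrite (le_lt_trans (exp2NS_le R j))// invf_lt1// ltr1n.
Qed.

Lemma jump_rate_gt0 j : 0 < jump_rate j.+1.
Proof. exact: lt_le_trans (exp2N_gt0 _ _) (jump_rate_ge j). Qed.

Lemma expR_jump_rate j : expR (- jump_rate j.+1) = 1 - 2 ^- j.+1.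
Proof.
rewrite /jump_rate opprK lnK// posrE subr_gt0.
by rewrite (le_lt_trans (exp2NS_le R j))// invf_lt1// ltr1n.
Qed.

Lemma measurable_holding_time j (B : set nat) :
  measurable (holding_time j @^-1` B).
Proof.
pose f (z : int) := (if z is Posz n then n else 0%N).+1.
rewrite (_ : _ @^-1` B =
    (fun y : R => Num.floor (2 * y / jump_rate j)) @^-1` (f @^-1` B)).
  apply: measurable_preimage_floor.
  by apply: measurable_funM => //; exact: measurable_funM.
apply/funext => y; rewrite /preimage/= /holding_time truncEfloor /f.
by case: Num.floor.
Qed.

(** The holding time is geometric: it exceeds [r] when no jump from level [j]
    happens in [r] trials. *)
Lemma holding_time_tail j r :
  exponential_prob (2 : R) [set y | (r < holding_time j y)%N] =
  ((1 - 2 ^- j) ^+ r)%:E.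
Proof.
case: r => [|r].
  rewrite (_ : [set _ | _] = setT); last exact/seteqP.
  by rewrite expr0 /exponential_prob integral_exponential_pdf.
case: j => [|j].
  rewrite (_ : [set _ | _] = set0); last first.
    by apply/seteqP; split => // y; rewrite /= /holding_time jump_rate0 invr0 mulr0 truncn0.
  by rewrite expr0 invr1 subrr expr0n /exponential_prob integral_set0.
have j0 := jump_rate_gt0 j.
rewrite (_ : [set _ | _] = `[r.+1%:R * jump_rate j.+1 / 2, +oo[%classic).
  rewrite exponential_prob_itvy//; last by rewrite !mulr_ge0// ltW.
  rewrite -expR_jump_rate -expRM_natl; congr (expR _)%:E.
  by field.
apply/seteqP; split => y; rewrite /= in_itv/= andbT /holding_time ltnS truncn_gt_nat;
by rewrite ler_pdivlMr// ler_pdivrMr// [2 * y]mulrC.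
Qed.

Lemma exponential_holding_time j r :
  exponential_prob (2 : R) [set y | holding_time j y = r.+1] =
  ((1 - 2 ^- j) ^+ r * 2 ^- j)%:E.
Proof.
have mH s : measurable [set y | (s < holding_time j y)%N].
  exact: (measurable_holding_time j [set n | (s < n)%N]).
rewrite (_ : [set _ | _] = [set y | (r < holding_time j y)%N] `\`
                           [set y | (r.+1 < holding_time j y)%N]).
  rewrite [LHS](@measureD _ _ _ (exponential_prob 2))//.
  - rewrite setIidr; last by move=> y /=; apply: ltnW.
    rewrite [X in (X - _)%E]holding_time_tail [X in (_ - X)%E]holding_time_tail.
    by rewrite -EFinB exprSr; congr EFin; ring.
  - exact: mH.
  - exact: mH.
  - by rewrite [ltLHS]holding_time_tail ltry.
apply/seteqP; split => y /=.
  by move=> ->; rewrite ltnSn ltnn.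
by move=> [ry /negP]; rewrite -leqNgt => yr; apply/eqP; rewrite eqn_leq yr.
Qed.

End holding_times.

Section hitting_time.
Context d (T : measurableType d) (R : realType) (P : probability T R).
Variables (Y : nat -> {RV P >-> R}).

(** The time at which level [k] is reached.  The [Y i] are used in reverse order,
    the last level [K - 1] taking [Y 0]: in [hitting_time K K / 2 ^ K] the
    variable [Y l] then keeps the weight [2 ^- l] when [K] varies. *)
Definition hitting_time (K k : nat) (x : T) : nat :=
  \sum_(j < k) holding_time j (Y (K - j.+1) x).

Hypothesis iY : mutually_independent Y.
Hypothesis lawY : forall i, has_law (Y i) (exponential_prob 2).

(** Induction on the level, and for each level on the number of steps: the first
    trial at level [k] either succeeds or leaves a holding time with the same law. *)
Lemma indep_event_hitting_time K k n : (k <= K)%N ->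
  indep_event Y (fun i => i + k < K)%N
    [set x | (hitting_time K k x <= n)%N] (reach R n k).
Proof.
elim: k n => [|k IH] n kK.
  rewrite reachn0 (_ : [set _ | _] = setT); first exact: indep_eventT.
  by apply/seteqP; split => // x _ /=; rewrite /hitting_time big_ord0.
pose H x := holding_time k (Y (K - k.+1) x).
(* After r failed attempts to leave level k, the remaining holding time is
   geometric again. *)
suff mem r : indep_event Y (fun i => i + k.+1 < K)%N
    [set x | (r < H x)%N /\ (hitting_time K k x + (H x - r) <= n)%N]
    ((1 - 2 ^- k) ^+ r * reach R n k.+1).
  have := mem 0%N; rewrite expr0 mul1r; congr indep_event.
  have hS x : hitting_time K k.+1 x = (hitting_time K k x + H x)%N.
    exact: big_ord_recr.
  by apply/seteqP; split => x /=; rewrite hS subn0// => -[].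
elim: n r => [|n IHn] r.
  rewrite mulr0 (_ : [set _ | _] = set0); first exact: indep_event0.
  apply/seteqP; split => // x [/= rH].
  by rewrite leqn0 addn_eq0 subn_eq0 leqNgt rH andbF.
rewrite (_ : [set _ | _] =
    ([set x | (hitting_time K k x <= n)%N] `&`
     Y (K - k.+1) @^-1` [set y | holding_time k y = r.+1]) `|`
    [set x | (r.+1 < H x)%N /\ (hitting_time K k x + (H x - r.+1) <= n)%N]);
    last first.
  apply/seteqP; split => x /=.
    move=> [rH hn]; have [Hr|rH'] := leqP (H x) r.+1; [left|right].
      have Hr' : H x = r.+1 by apply/eqP; rewrite eqn_leq Hr.
      by split => //; move: hn; rewrite Hr' subSnn addn1.
    by split => //; move: hn; rewrite -(ltn_predK rH') subSS; lia.
  case => [[hn Hr]|[rH hn]].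
    by rewrite /H Hr subSnn addn1.
  by split; [exact: ltnW|move: hn; lia].
rewrite (_ : _ * _ = reach R n k * ((1 - 2 ^- k) ^+ r * 2 ^- k) +
    (1 - 2 ^- k) ^+ r.+1 * reach R n k.+1); last first.
  by rewrite reachSS exprSr; ring.
apply: indep_eventU; last exact: IHn.
  by apply/seteqP; split => // x [[_ /= Hr] []]; rewrite /H Hr ltnn.
apply: (@indep_event_sub _ _ _ _ _ _ _ _
    (fun i => (i + k < K) && (i != K - k.+1))%N).
  by move=> i /=; lia.
have mB : measurable [set y : R | holding_time k y = r.+1].
  exact: (measurable_holding_time k [set r.+1]).
apply: indep_eventI => //.
- by lia.
- by rewrite -[LHS]/(distribution P (Y _) _) lawY// exponential_holding_time.
- by apply: IH; exact: ltnW.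
Qed.

Lemma prob_hitting_time_le K n :
  P [set x | (hitting_time K K x <= n)%N] = (reach R n K)%:E.
Proof. exact: indep_event_prob (indep_event_hitting_time n (leqnn K)). Qed.

End hitting_time.

(** * Almost sure convergence of the rescaled hitting times *)

Section scaling.
Variable R : realType.

Lemma jump_rate_le j : jump_rate R j.+1 * (1 - 2 ^- j.+1) <= 2 ^- j.+1.
Proof.
rewrite /jump_rate.
move: (2 ^- j.+1) (exp2N_gt0 R j.+1) (exp2NS_le R j) => x x0 x2.
have x1 : 0 < 1 - x by lra.
rewrite -ler_pdivlMr// -lnV ?posrE//.
rewrite [X in ln X](_ : _ = 1 + x / (1 - x)); last by field; rewrite gt_eqF.
by rewrite le_ln1Dx// (lt_le_trans (ltrN10 _))// divr_ge0// ltW.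
Qed.

(** This bound and the next one say that a holding time at level [j] is
    [2 ^ (j + 1) * y] up to an error that does not depend on [j]. *)
Lemma holding_time_le j (y : R) : 0 <= y ->
  (holding_time j y)%:R <= 2 ^+ j.+1 * y + 1.
Proof.
move=> y0; rewrite /holding_time -natr1 lerD2r; case: j => [|j].
  by rewrite jump_rate0 invr0 mulr0 truncn0 mulr_ge0.
have l0 := jump_rate_gt0 R j.
apply: (@le_trans _ _ (2 * y / jump_rate R j.+1)).
  by rewrite truncn_le divr_ge0 ?mulr_ge0// ltW.
rewrite exprS -!mulrA ler_pM2l// [_ * y]mulrC ler_wpM2l//.
by rewrite -[leRHS]invrK lef_pV2 ?posrE// ?jump_rate_ge// exp2N_gt0.
Qed.

Lemma holding_time_ge j (y : R) : 0 <= y ->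
  2 ^+ j.+1 * y - 2 * y <= (holding_time j y)%:R.
Proof.
move=> y0; case: j => [|j].
  by rewrite expr1 subrr.
have l0 := jump_rate_gt0 R j.
apply: (@le_trans _ _ (2 * y / jump_rate R j.+1)); last first.
  by rewrite ltW// /holding_time -truncn_le_nat.
rewrite ler_pdivlMr//.
have le1 : jump_rate R j.+1 * (2 ^+ j.+1 - 1) <= 1.
  have e0 : 0 < 2 ^+ j.+1 :> R by rewrite exprn_gt0.
  have := jump_rate_le j; rewrite -[leRHS]mul1r ler_pdivlMr//.
  by rewrite -mulrA mulrBl mul1r mulVf ?gt_eqF.
have -> : (2 ^+ j.+2 * y - 2 * y) * jump_rate R j.+1 =
    2 * y * (jump_rate R j.+1 * (2 ^+ j.+1 - 1)) by rewrite [2 ^+ j.+2]exprS; ring.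
by rewrite ler_piMr// mulr_ge0.
Qed.

(** The geometric growth condition makes the series converge and bounds the sum of
    the errors by a multiple of [(3 / 2) ^ K], which [2 ^ K] dominates. *)
Lemma cvg_hitting_time (y : nat -> R) (C : R) :
  (forall l, 0 <= y l <= C * (3 / 2) ^+ l) ->
  (\sum_(j < K) holding_time j (y (K - j.+1)%N))%:R / 2 ^+ K @[K --> \oo] -->
  limn (series (fun l => 2 ^- l * y l)).
Proof.
move=> yC.
have y0 l : 0 <= y l by have /andP[] := yC l.
have C0 : 0 <= C by have /andP[] := yC 0%N; rewrite expr0 mulr1; exact: le_trans.
have q1 : `|3 / 4| < 1 :> R by rewrite ger0_norm; lra.
have S2 : cvgn (series (fun l => 2 ^- l * y l)).
  apply: (@series_le_cvg _ _ (geometric C (3 / 4))) => [l|l|l|].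
  - by rewrite mulr_ge0// ltW// exp2N_gt0.
  - by rewrite geometric_ge0//; lra.
  - have /andP[_ yl] := yC l; rewrite /geometric/= mulrC ler_pdivrMr ?exprn_gt0//.
    by rewrite -mulrA -exprMn (_ : 3 / 4 * 2 = 3 / 2)//; field.
  - exact: is_cvg_geometric_series.
pose u := series (fun l => 2 ^- l * y l).
pose h K := (\sum_(j < K) holding_time j (y (K - j.+1)%N))%:R / 2 ^+ K : R.
(* Reindexing by the variables [y l] makes [h K] and [u K] comparable termwise. *)
have hE K : h K = \sum_(l < K) (holding_time (K - l.+1) (y l))%:R / 2 ^+ K.
  rewrite /h natr_sum mulr_suml (reindex_inj rev_ord_inj)/=.
  by apply: eq_bigr => l _; rewrite subnSK// subKn// ltnW.
have uE K : u K = \sum_(l < K) (2 ^+ (K - l.+1).+1 * y l) / 2 ^+ K.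
  rewrite /u /series/= big_mkord; apply: eq_bigr => l _; rewrite subnSK//.
  rewrite -[X in _ / 2 ^+ X](subnK (ltnW (ltn_ord l))) exprD.
  by field; rewrite !expf_neq0.
have K1 K : K%:R <= 2 * (3 / 2) ^+ K :> R.
  elim: K => [|K IH]; first by rewrite expr0 mulr1.
  rewrite -natr1 exprS.
  have : 1 <= (3 / 2) ^+ K :> R by rewrite exprn_ege1//; lra.
  lra.
have yK K : \sum_(l < K) y l <= 2 * C * (3 / 2) ^+ K.
  elim: K => [|K IH]; first by rewrite big_ord0 expr0 mulr1 mulr_ge0.
  rewrite big_ord_recr/= exprS.
  have /andP[_] := yC K.
  set z := (3 / 2) ^+ K in IH *.
  lra.
have e4 K : (3 / 2) ^+ K / 2 ^+ K = (3 / 4) ^+ K :> R.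
  by rewrite -expr_div_n; congr (_ ^+ _); field.
have e0 : (4 * C + 2) * (3 / 4) ^+ K @[K --> \oo] --> (0 : R).
  exact: cvg_geometric.
have d0 : h K - u K @[K --> \oo] --> 0.
  apply: norm_cvg0; apply: (squeeze_cvgr _ (cvg_cst 0) e0).
  apply: nearW => K; rewrite normr_ge0/= hE uE -sumrB.
  have p2 : 0 < 2 ^- K :> R by exact: exp2N_gt0.
  under eq_bigr do rewrite -mulrBl.
  rewrite -mulr_suml -e4 mulrA normrM (gtr0_norm p2) ler_pM2r//.
  rewrite ler_norml; apply/andP; split.
    apply: (@le_trans _ _ (\sum_(l < K) - (2 * y l))); last first.
      apply: ler_sum => l _; rewrite lerBrDl; exact: holding_time_ge.
    rewrite sumrN lerN2 -mulr_sumr.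
    have := yK K; have := K1 K; have := ler0n R K; lra.
  apply: (@le_trans _ _ (\sum_(l < K) 1)).
    apply: ler_sum => l _; rewrite lerBlDl; exact: holding_time_le.
  rewrite sumr_const card_ord.
  have : 0 <= C * (3 / 2) ^+ K by rewrite mulr_ge0// exprn_ge0//; lra.
  have := K1 K; lra.
rewrite (_ : (fun K => _) = (fun K => u K + (h K - u K))).
  by rewrite -[X in _ --> X]addr0; exact: cvgD.
by apply/funext => K; rewrite addrC subrK.
Qed.

End scaling.

Section almost_surely.
Context d (T : measurableType d) (R : realType) (P : probability T R).

(** Dominated convergence for indicator functions. *)
Lemma cvg_probability (A : nat -> set T) (B : set T) :
  (forall m, measurable (A m)) -> measurable B ->
  {ae P, forall x, \forall m \near \oo, A m x <-> B x} ->
  P (A m) @[m --> \oo] --> P B.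
Proof.
move=> mA mB AB.
have := @dominated_convergence _ _ _ P setT measurableT
  (fun m x => (\1_(A m) x)%:E) (fun x => (\1_B x)%:E) (cst 1%E).
case.
- by move=> m; apply/measurable_EFinP; exact: measurable_indic.
- by apply/measurable_EFinP; exact: measurable_indic.
- apply: filterS AB => x ABx _.
  apply: cvg_near_cst; apply: filterS ABx => m ABx.
  rewrite !indicE (_ : (x \in A m) = (x \in B))//.
  by apply/idP/idP; rewrite !inE => /ABx.
- exact: finite_measure_integrable_cst.
- apply: aeW => x m _; rewrite /= lee_fin ger0_norm indicE ?ler0n//.
  by rewrite lern1 leq_b1.
move=> _ _; rewrite integral_indic// setIT.
by under eq_fun do rewrite integral_indic// setIT.
Qed.

Variable Y : nat -> {RV P >-> R}.
Hypothesis lawY : forall i, has_law (Y i) (exponential_prob 2).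

Lemma exponential_tail i (a : R) : 0 <= a ->
  P (Y i @^-1` `[a, +oo[) = (expR (- 2 * a))%:E.
Proof.
move=> a0; rewrite -[LHS]/(distribution P (Y i) _) lawY//.
exact: exponential_prob_itvy.
Qed.

(** By the Borel-Cantelli lemma, [Y l < (3 / 2) ^ l] for all but finitely many
    [l]; the constant accounts for the exceptions.  Any ratio strictly between [1] and [2] would do. *)
Lemma ae_exponential_growth :
  {ae P, forall x, exists C : R, forall l, 0 <= Y l x <= C * (3 / 2) ^+ l}.
Proof.
pose F l := Y l @^-1` `[(3 / 2) ^+ l, +oo[.
have mF l : measurable (F l).
  by apply: measurable_funPTI; exact: measurable_itv.
(* The tail [expR (- 2 * a)] is at most [1 / a]. *)
have expB l : expR (- 2 * (3 / 2) ^+ l) <= (2 / 3) ^+ l :> R.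
  have p : 0 < (3 / 2) ^+ l :> R by rewrite exprn_gt0//; lra.
  rewrite (_ : 2 / 3 = (3 / 2)^-1); last by field.
  rewrite exprVn mulNr expRN lef_pV2 ?posrE ?expR_gt0//.
  by apply: le_trans (expR_ge1Dx _); lra.
have F0 : P (lim_sup_set F) = 0.
  apply: lim_sup_set_cvg0 => //.
  apply: (@le_lt_trans _ _ (\sum_(l <oo) ((geometric 1 (2 / 3 : R)) l)%:E)%E).
    apply: lee_nneseries => l _ //; rewrite /F [leLHS]exponential_tail.
      by rewrite lee_fin /geometric/= mul1r.
    by rewrite exprn_ge0//; lra.
  have q1 : `|2 / 3| < 1 :> R by rewrite ger0_norm; lra.
  have cg : cvgn (series (geometric 1 (2 / 3 : R))).
    exact: is_cvg_geometric_series.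
  under eq_fun do rewrite sumEFin.
  by rewrite (EFin_lim cg) ltry.
have N0 : P.-negligible (\bigcup_l (Y l @^-1` `]-oo, 0[)).
  apply: negligible_bigcup => l; exists (Y l @^-1` `]-oo, 0[); split => //.
    by apply: measurable_funPTI; exact: measurable_itv.
  rewrite (_ : _ @^-1` _ = ~` (Y l @^-1` `[0, +oo[)).
    rewrite [LHS](probability_setC P); last by apply: measurable_funPTI; exact: measurable_itv.
    by rewrite [X in (1 - X)%E]exponential_tail// mulr0 expR0 subee.
  rewrite preimage_setC; congr (_ @^-1` _).
  by rewrite setCitvr.
have Fneg : P.-negligible (lim_sup_set F).
  exists (lim_sup_set F); split => //.
  by apply: bigcap_measurable => // k _; exact: bigcup_measurable.
have := negligibleU N0 Fneg.
apply: negligibleS => x /= nC; apply: contrapT => /not_orP[nN nF]; apply: nC.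
have y0 l : 0 <= Y l x.
  rewrite leNgt; apply/negP => yl; apply: nN.
  by exists l.
have [k Fk] : exists k, forall l, (k <= l)%N -> Y l x <= (3 / 2) ^+ l.
  have /existsNP[k nk] := nF.
  exists k => l kl; rewrite leNgt; apply/negP => yl; apply: nk => _.
  by exists l => //; rewrite /F/= in_itv/= andbT ltW.
exists (1 + \sum_(i < k) Y i x) => l; rewrite y0/=.
have s0 : 0 <= \sum_(i < k) Y i x by apply: sumr_ge0.
have p1 : 1 <= (3 / 2) ^+ l :> R by rewrite exprn_ege1//; lra.
have [/Fk/le_trans->//|lk] := leqP k l.
  by rewrite ler_peMl ?lerDl// (le_trans _ p1).
apply: (@le_trans _ _ (1 + \sum_(i < k) Y i x)).
  rewrite (bigD1 (Ordinal lk))//= addrCA lerDl addr_ge0//.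
  exact: sumr_ge0.
by rewrite ler_peMr// addr_ge0.
Qed.

End almost_surely.

(** * Convergence of the reaching probabilities *)

Section hitting_time_limit.
Context d (T : measurableType d) (R : realType) (P : probability T R).
Variable Y : nat -> {RV P >-> R}.
Hypothesis iY : mutually_independent Y.
Hypothesis lawY : forall i, has_law (Y i) (exponential_prob 2).

Let W K x : R := (hitting_time Y K K x)%:R / 2 ^+ K.

Lemma ae_cvg_hitting_time :
  {ae P, forall x, W K x @[K --> \oo] --> S_infty Y x}.
Proof.
apply: filterS (ae_exponential_growth lawY) => x [C yC].
exact: (@cvg_hitting_time _ (fun l => Y l x) C yC).
Qed.

Lemma hitting_time_gt0 K x : (0 < hitting_time Y K.+1 K.+1 x)%N.
Proof. by rewrite /hitting_time big_ord_recl. Qed.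

Lemma measurable_hitting_time K k (A : set nat) :
  measurable (hitting_time Y K k @^-1` A).
Proof.
elim: k A => [|k IH] A.
  rewrite (_ : hitting_time Y K 0 = cst 0%N); last first.
    by apply/funext => x; rewrite /hitting_time big_ord0.
  by rewrite preimage_cst; case: ifP.
rewrite (_ : _ @^-1` A = \bigcup_m (hitting_time Y K k @^-1` [set n | A (n + m)%N]
    `&` Y (K - k.+1) @^-1` (holding_time k @^-1` [set m]))).
  apply: bigcup_measurable => m _; apply: measurableI; first exact: IH.
  by apply: measurable_funPTI; exact: measurable_holding_time.
have hS x : hitting_time Y K k.+1 x =
    (hitting_time Y K k x + holding_time k (Y (K - k.+1) x))%N.
  exact: big_ord_recr.
apply/seteqP; split => x /=; rewrite hS.
  by move=> Ax; exists (holding_time k (Y (K - k.+1) x)).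
by move=> [m _ [/= Am ->]].
Qed.

(** An interval of length [2 * e] contains about [2 * e * 2 ^ (k + 1)] integers
    at the scale [2 ^ (k + 1)], each of which has mass at most [2 ^- k]. *)
Lemma prob_hitting_time_near k (x e : R) : 0 <= x -> 0 < e ->
  (P [set t | `|W k.+1 t - x| < e]%R <= (4 * e + 2 ^- k)%:E)%E.
Proof.
move=> x0 e0; pose a := (x - e) * 2 ^+ k.+1; pose b := (x + e) * 2 ^+ k.+1.
have p0 : 0 < 2 ^+ k.+1 :> R by rewrite exprn_gt0.
have b0 : 0 <= b by rewrite mulr_ge0 ?addr_ge0// ltW.
pose N := Num.truncn a; pose M := Num.truncn b.
have NM : (N <= M)%N.
  by apply: le_truncn; rewrite ler_pM2r//; lra.
pose h := hitting_time Y k.+1 k.+1.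
apply: (@le_trans _ _ (P ([set t | (h t <= M)%N] `\` [set t | (h t <= N)%N]))).
  apply: le_measure; rewrite ?inE.
  - apply: (measurable_hitting_time _ _ [set n : nat | `|n%:R / 2 ^+ k.+1 - x| < e]).
  - by apply: measurableD; exact: (measurable_hitting_time _ _ [set n : nat | (n <= _)%N]).
  move=> t /=; rewrite ltr_distl /W ltr_pdivlMr// ltr_pdivrMr// => /andP[ah hb].
  split; first by rewrite /M truncn_ge_nat// ltW.
  apply/negP; rewrite -ltnNge; have [a0|a0] := leP 0 a.
    by rewrite truncn_lt_nat.
  (* For negative [a] the truncation is [0], below every hitting time. *)
  rewrite (_ : N = 0%N) ?hitting_time_gt0//.
  apply/eqP; rewrite -leqn0 truncn_le_nat; lra.
rewrite measureD.
- rewrite setIidr; last by move=> t /= /leq_trans; exact.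
  rewrite [X in (X - _)%E]prob_hitting_time_le// [X in (_ - X)%E]prob_hitting_time_le//.
  rewrite -EFinB lee_fin -{1}(subnK NM) (le_trans (reach_increment _ _ _ _))//.
  rewrite natrB//.
  have MN : M%:R - N%:R <= b - a + 1.
    have : M%:R <= b by rewrite truncn_le.
    have : a < N.+1%:R by rewrite -truncn_le_nat.
    by rewrite -[N.+1%:R]natr1; lra.
  apply: (le_trans (ler_wpM2r _ MN)); first by rewrite ltW// exp2N_gt0.
  rewrite /b /a exprS le_eqVlt; apply/orP; left; apply/eqP; field.
  by rewrite expf_neq0.
- exact: (measurable_hitting_time _ _ [set n : nat | (n <= _)%N]).
- exact: (measurable_hitting_time _ _ [set n : nat | (n <= _)%N]).
- by rewrite [ltLHS]prob_hitting_time_le// ltry.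
Qed.

Let mS : measurable_fun setT (S_infty Y) := measurable_funPT _.

(** The mass at [x] is bounded by the mass that the rescaled hitting times put
    near [x], which is small at all high levels. *)
Lemma S_infty_atomless (x : R) : 0 <= x -> P [set t | S_infty Y t = x] = 0%E.
Proof.
move=> x0; apply/eqP; rewrite eq_le measure_ge0 andbT.
have mSx : measurable [set t | S_infty Y t = x].
  by rewrite -[X in measurable X]setTI; exact: (mS measurableT (measurable_set1 x)).
apply/lee_addgt0Pr => e e0; rewrite add0e.
have e6 : 0 < e / 6 by rewrite divr_gt0.
pose A K := [set t | S_infty Y t = x] `&` ~` [set t | `|W K t - x| < e / 6]%R.
have mW K : measurable [set t | `|W K t - x| < e / 6]%R.
  exact: (measurable_hitting_time _ _ [set n : nat | `|n%:R / 2 ^+ K - x| < _]).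
have A0 : P (A K) @[K --> \oo] --> 0%E.
  rewrite -(measure0 P); apply: cvg_probability => //.
    by move=> K; apply: measurableI => //; exact: measurableC.
  apply: filterS ae_cvg_hitting_time => t Wt.
  have [Stx|Stx] := eqVneq (S_infty Y t) x; last first.
    by apply: nearW => K; split => // -[/eqP]; rewrite (negbTE Stx).
  rewrite Stx in Wt.
  have /cvgr_dist_lt/(_ _ e6) := Wt; apply: filterS => K; rewrite distrC => WK.
  by split => // -[_ /=].
have [k [Ak k2]] : exists k, (P (A k.+1) < (e / 6)%:E)%E /\ 2 ^- k < e / 6.
  have g2 : 2 ^- k @[k --> \oo] --> (0 : R).
    have h1 : `|2^-1| < 1 :> R by rewrite gtr0_norm// invf_lt1// ltr1n.
    have := cvg_geometric (1 : R) h1; rewrite (_ : geometric 1 2^-1 = (fun k => 2 ^- k))//.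
    by apply/funext => k; rewrite /geometric/= mul1r exprVn.
  have /cvgr_dist_lt/(_ _ e6) g2' := g2.
  have A0' : \forall k \near \oo, (P (A k) < (e / 6)%:E)%E.
    exact: (A0 _ (@nbhs_open_ereal_lt _ 0 (fun=> e / 6) e6)).
  have [k _ kP] := filterI g2' A0'.
  exists k; split.
    by have [_] := kP k.+1 (leqnSn k).
  have [+ _] := kP k (leqnn k); rewrite /= sub0r normrN.
  by rewrite ger0_norm// ltW// exp2N_gt0.
rewrite (_ : [set t | _] = A k.+1 `|` ([set t | S_infty Y t = x] `&` [set t | `|W k.+1 t - x| < e / 6]%R)).
  apply: (le_trans (measureU2 _ _ _)).
  - by apply: measurableI => //; exact: measurableC.
  - exact: measurableI.
  apply: (@le_trans _ _ ((e / 6)%:E + (4 * (e / 6) + 2 ^- k)%:E)%E).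
    apply: leeD; first exact: ltW.
    apply: le_trans (prob_hitting_time_near k x0 e6).
    by apply: le_measure; rewrite ?inE//; exact: measurableI.
  by rewrite -EFinD lee_fin; lra.
by rewrite /A setUC setUIDK.
Qed.

(** The rescaled hitting times converge almost surely and the limit does not
    charge the boundary point [x], so the indicators converge almost surely. *)
Lemma cvg_reach (n K : nat -> nat) (x : R) : 0 <= x ->
  K @ \oo --> \oo -> (n m)%:R / 2 ^+ K m @[m --> \oo] --> x ->
  (reach R (n m) (K m))%:E @[m --> \oo] --> P [set t | S_infty Y t <= x].
Proof.
move=> x0 Koo nx.
under eq_fun do rewrite -(prob_hitting_time_le iY lawY).
apply: cvg_probability.
- by move=> m; exact: (measurable_hitting_time _ _ [set i | (i <= _)%N]).
- rewrite -[X in measurable X]setTI.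
  exact: (mS measurableT (measurable_itv `]-oo, x])).
have Sx : {ae P, forall t, S_infty Y t <> x}.
  exists [set t | S_infty Y t = x]; split.
  - by rewrite -[X in measurable X]setTI; exact: (mS measurableT (measurable_set1 x)).
  - exact: S_infty_atomless.
  - by move=> t /= /contrapT.
apply: filterS2 ae_cvg_hitting_time Sx => t Wt Stx.
have Wn : W (K m) t - (n m)%:R / 2 ^+ K m @[m --> \oo] --> S_infty Y t - x.
  by apply: cvgB => //; exact: (cvg_comp _ _ Koo Wt).
have cmp m : (hitting_time Y (K m) (K m) t <= n m)%N =
    (W (K m) t - (n m)%:R / 2 ^+ K m <= 0).
  by rewrite subr_le0 ler_pM2r ?exp2N_gt0// ler_nat.
have [lt|gt|//] := ltgtP (S_infty Y t) x.
  have := cvgr_lt _ Wn 0; rewrite subr_lt0 => /(_ _ lt).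
  by apply: filterS => m /ltW le0; split => _ /=; [exact: ltW|rewrite cmp].
have := cvgr_gt _ Wn 0; rewrite subr_gt0 => /(_ _ gt).
apply: filterS => m gt0; split => /=.
  by rewrite cmp leNgt gt0.
by rewrite leNgt gt.
Qed.

End hitting_time_limit.

(** * Weak convergence to a law on the integers *)

Section weak.
Variable R : realType.
Implicit Types (mu nu : probability R R) (f : R -> R).

(** An enumeration of the integers, seen as real numbers. *)
Definition int_of_index (i : nat) : R :=
  (if odd i then Negz i./2 else Posz i./2)%:~R.

Lemma int_of_index_inj : injective int_of_index.
Proof.
move=> i j /intr_inj; case: ifPn => oi; case: ifPn => oj // => -[h];
by rewrite -(odd_double_half i) -(odd_double_half j) h ?oi ?oj ?(negbTE oi) ?(negbTE oj).
Qed.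

Lemma range_int_of_index : range int_of_index = range intr.
Proof.
apply/seteqP; split => [_ [i _ <-]|_ [[i|i] _ <-]]; first by eexists.
  by exists i.*2 => //; rewrite /int_of_index odd_double doubleK.
by exists i.*2.+1 => //; rewrite /int_of_index /= odd_double/= uphalf_double.
Qed.

Let integral_set1 mu f a :
  (\int[mu]_(x in [set a]) (f x)%:E = (f a)%:E * mu [set a])%E.
Proof.
rewrite (eq_integral (fun=> (f a)%:E)); last by move=> x; rewrite inE/= => ->.
by rewrite integral_cst.
Qed.

Lemma integral_range_int mu f : measurable_fun setT f -> (forall x, 0 <= f x) ->
  (\int[mu]_(x in range intr) (f x)%:E =
   \sum_(i <oo) (f (int_of_index i))%:E * mu [set int_of_index i])%E.
Proof.
move=> mf f0.
rewrite -range_int_of_index (_ : range _ = \bigcup_i [set int_of_index i]).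
  rewrite ge0_integral_bigcup//.
  - by apply: eq_eseriesr => i _; rewrite integral_set1.
  - apply/measurable_funTS; exact/measurable_EFinP.
  - by move=> x _; rewrite lee_fin.
  - by move=> i j _ _ [x [/= -> /int_of_index_inj]].
by apply/seteqP; split => [_ [i _ <-]|_ [i _ /= ->]]; exists i.
Qed.

(** Fatou's lemma for the sum over the integers: finitely many integers carry the
    integral of [f] up to [e / 2], and on them the masses converge. *)
Lemma mass_lower (mu_ : nat -> probability R R) nu f (e : R) :
  (forall j : int, mu_ m [set j%:~R] @[m --> \oo] --> nu [set j%:~R]) ->
  nu (~` range intr) = 0%E ->
  measurable_fun setT f -> (forall x, 0 <= f x) ->
  (\int[nu]_x (f x)%:E < +oo)%E -> 0 < e ->
  \forall m \near \oo,
   (\int[nu]_x (f x)%:E <= \int[mu_ m]_x (f x)%:E + e%:E)%E.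
Proof.
move=> munu nu0 mf f0 fi e0.
have mZ : measurable (range (intr : int -> R)).
  rewrite -range_int_of_index; apply: countable_measurable => //.
  exact: card_image_le.
have g0 mu i : (0 <= (f (int_of_index i))%:E * mu [set int_of_index i])%E.
  by rewrite mule_ge0// lee_fin.
have nuE : (\int[nu]_x (f x)%:E = \int[nu]_(x in range intr) (f x)%:E)%E.
  rewrite (ge0_negligible_integral (measurableC mZ))//.
  - by rewrite setTD setCK.
  - exact/measurable_EFinP.
  - by move=> x _; rewrite lee_fin.
pose u mu i := ((f (int_of_index i))%:E * mu [set int_of_index i])%E.
have [N tN] : exists N, (\sum_(N <= i <oo) u nu i <= (e / 2)%:E)%E.
  have : (\sum_(N <= i <oo) u nu i)%E @[N --> \oo] --> 0%E.
    apply: (@nneseries_tail_cvg _ _ xpredT) => [|i _]; last exact: g0.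
    by rewrite -integral_range_int// -nuE.
  have e2 : (0 < (e / 2)%:E :> \bar R)%E by rewrite lte_fin divr_gt0.
  move=> /(_ _ (@nbhs_open_ereal_lt _ 0 (fun=> e / 2) e2))[N _ uN].
  by exists N; apply/ltW/uN => /=.
pose s mu : R := \sum_(0 <= i < N) f (int_of_index i) * fine (mu [set int_of_index i] : \bar R).
have sE mu : (\sum_(0 <= i < N) u mu i)%E = (s mu)%:E.
  rewrite -sumEFin; apply: eq_bigr => i _.
  by rewrite EFinM fineK// fin_num_measure.
have smu : s (mu_ m) @[m --> \oo] --> s nu.
  apply: (@fine_cvg _ _ _ _ (fun m => (s (mu_ m))%:E)); rewrite -sE.
  under eq_fun do rewrite -sE.
  apply: cvg_nnesum => i _; first by apply: nearW => m; exact: g0.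
  by apply: cvgeZl => //; exact: munu.
have e2 : 0 < e / 2 by rewrite divr_gt0.
have /cvgr_dist_lt/(_ _ e2) := smu; apply: filterS => m; rewrite ltr_distl => /andP[_ sm].
apply: (@le_trans _ _ ((s nu)%:E + (e / 2)%:E)%E).
  rewrite nuE integral_range_int// -sE (nneseries_split 0 N)//.
  by rewrite add0n leeD2l.
apply: (@le_trans _ _ ((s (mu_ m))%:E + e%:E)%E).
  by rewrite -!EFinD lee_fin; lra.
rewrite leeD2r// -sE.
apply: (@le_trans _ _ (\int[mu_ m]_(x in range intr) (f x)%:E)%E).
  rewrite integral_range_int//; apply: nneseries_lim_ge => i _ _; exact: g0.
apply: ge0_subset_integral => //; first exact/measurable_EFinP.
by move=> x _; rewrite lee_fin.
Qed.

(** A bounded function [f] gives two nonnegative ones, [C + f] and [C - f], and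
    the lower bounds for both squeeze the integral of [f]. *)
Lemma weakly_converges_mass (mu_ : nat -> probability R R) nu :
  (forall j : int, mu_ m [set j%:~R] @[m --> \oo] --> nu [set j%:~R]) ->
  nu (~` range intr) = 0%E -> weakly_converges mu_ nu.
Proof.
move=> munu nu0 f cf [M [_ fM]].
have mf : measurable_fun setT f by exact: continuous_measurable_fun.
pose C := `|M| + 1.
have fC x : `|f x| <= C.
  by apply: (fM C) => //; rewrite /C (le_lt_trans (ler_norm M))// ltrDl.
have intf mu : mu.-integrable setT (EFin \o f).
  apply: measurable_bounded_integrable => //.
    by rewrite [ltLHS]probability_setT ltry.
  by exists M; split=> //; exact: num_real.
pose I mu := fine (\int[mu]_x (f x)%:E)%E.
have IE mu : (\int[mu]_x (f x)%:E)%E = (I mu)%:E.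
  by rewrite fineK//; apply: integrable_fin_num => //; exact: intf.
have IC (b : bool) mu :
    (\int[mu]_x (C + (-1) ^+ b * f x)%:E)%E = (C + (-1) ^+ b * I mu)%:E.
  under eq_integral do rewrite EFinD EFinM.
  rewrite integralD//.
  - rewrite integralZl//; last exact: intf.
    by rewrite [X in (_ + _ * X)%E]IE integral_cst// [X in (_ * X + _)%E]probability_setT mule1.
  - exact: finite_measure_integrable_cst.
  - by apply: integrableZl => //; exact: intf.
rewrite IE; apply/cvg_EFin.
  by apply: nearW => m; rewrite IE.
apply/cvgrPdist_le => e e0.
have lower (b : bool) : \forall m \near \oo,
    (C + (-1) ^+ b * I nu <= C + (-1) ^+ b * I (mu_ m) + e).
  have /= := @mass_lower mu_ nu (fun x => C + (-1) ^+ b * f x) e munu nu0.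
  rewrite IC ltry => mass.
  have : \forall m \near \oo, ((C + (-1) ^+ b * I nu)%:E <=
      \int[mu_ m]_x (C + (-1) ^+ b * f x)%:E + e%:E)%E.
    apply: mass => //.
      by apply: measurable_funD => //; exact: measurable_funM.
    move=> x; rewrite -lerBlDl sub0r.
    by have := fC x; rewrite ler_norml => /andP[]; case: b; rewrite ?expr0 ?expr1; lra.
  by apply: filterS => m; rewrite IC -EFinD lee_fin.
apply: filterS2 (lower true) (lower false) => m.
rewrite /= expr0 expr1 !mul1r !mulN1r -/(I (mu_ m)).
by move: (I nu) (I (mu_ m)) => x y hi lo; rewrite ler_norml; lra.
Qed.

End weak.

(** * The limit law *)

Section limit_law.
Context d (T : measurableType d) (R : realType) (P : probability T R).

Lemma eq_probability_ae (A B : set T) : measurable A -> measurable B ->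
  {ae P, forall x, A x <-> B x} -> P A = P B.
Proof.
move=> mA mB AB.
have PB : P A @[m --> \oo] --> P B.
  apply: (@cvg_probability _ _ _ P (fun=> A)) => //.
  by apply: filterS AB => x ABx; exact: nearW.
exact: (cvg_unique (@ereal_hausdorff R) (cvg_cst (P A)) PB).
Qed.

Variable Y : nat -> {RV P >-> R}.
Hypothesis iY : mutually_independent Y.
Hypothesis lawY : forall i, has_law (Y i) (exponential_prob 2).

(** Positivity matters because [ln] is [0] on nonpositive numbers. *)
Lemma ae_S_infty_gt0 : {ae P, forall t, 0 < S_infty Y t}.
Proof.
have S0 : {ae P, forall t, S_infty Y t <> 0}.
  exists [set t | S_infty Y t = 0]; split.
  - exact: (measurable_funPTI (S_infty Y) (measurable_set1 0)).
  - exact: S_infty_atomless.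
  - by move=> t /= /contrapT.
apply: filterS2 (ae_cvg_hitting_time lawY) S0 => t Wt /eqP St.
rewrite lt_neqAle eq_sym St/= -(cvg_lim _ Wt)//.
apply: limr_ge; first by apply/cvg_ex; exists (S_infty Y t).
by apply: nearW => K; rewrite divr_ge0// exprn_ge0.
Qed.

Lemma ln2_gt0 : 0 < ln 2 :> R.
Proof. by rewrite ln_gt0// ltr1n. Qed.

Lemma le_log2 (s c : R) : 0 < s -> (log2 s <= c) = (s <= expR (c * ln 2)).
Proof.
move=> s0; rewrite /log2 ler_pdivrMr ?ln2_gt0//.
by rewrite -[in RHS](lnK s0) ler_expR.
Qed.

Lemma prob_limit_depth (eta : R) (j : int) :
  P [set t | limit_depth Y eta t = j%:~R] =
  (P [set t | (S_infty Y t <= expR ((eta - j%:~R) * ln 2))%R] -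
   P [set t | (S_infty Y t <= expR ((eta - (j + 1)%:~R) * ln 2))%R])%E.
Proof.
have mS c : measurable [set t | (S_infty Y t <= c)%R].
  exact: (measurable_funPTI (S_infty Y) (measurable_itv `]-oo, c])).
rewrite -[X in (_ - P X)%E](@setIidr _ [set t | (S_infty Y t <= expR ((eta - j%:~R) * ln 2))%R]).
  rewrite -measureD//; last by rewrite ltey_eq fin_num_measure.
  apply: eq_probability_ae.
  - exact: (measurable_funPTI (limit_depth Y eta) (measurable_set1 _)).
  - exact: measurableD.
  apply: filterS ae_S_infty_gt0 => t S0 /=.
  rewrite -!le_log2//; split.
    move=> /intr_inj fj; have := floor_itv (- log2 (S_infty Y t) + eta).
    rewrite fj => /andP[lo hi]; split; first by lra.
    by apply/negP; rewrite -ltNge; lra.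
  move=> [hi /negP]; rewrite -ltNge => lo.
  rewrite /limit_depth; congr (_%:~R); apply: floor_def.
  by apply/andP; split; lra.
move=> t /= /le_trans; apply; rewrite ler_expR ler_pM2r ?ln2_gt0//.
by rewrite intrD; lra.
Qed.

Lemma limit_depth_int (eta : R) :
  distribution P (limit_depth Y eta) (~` range intr) = 0%E.
Proof.
rewrite /distribution/= /pushforward (_ : _ @^-1` _ = set0) ?measure0//.
by apply/seteqP; split => // t; apply; eexists.
Qed.

Variables (n : nat -> nat) (eta : R).
Hypothesis n_gt0 : forall m, (0 < n m)%N.
Hypothesis noo : n @ \oo --> \oo.
Hypothesis neta : frac_part (log2 ((n m)%:R : R)) @[m --> \oo] --> eta.

Let L m : int := Num.floor (log2 ((n m)%:R : R)).

(** The integer part of [log2 (n m)] tends to infinity, so that [L m + j] is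
    eventually a natural number whatever the sign of [j]. *)
Lemma near_floor_log2_ge (M : int) : \forall m \near \oo, M <= L m.
Proof.
pose x : R := expR (M%:~R * ln 2).
have /cvgnyPge/(_ (Num.truncn x).+1) := noo; apply: filterS => m xn.
rewrite /L floor_ge_int /log2 ler_pdivlMr ?ln2_gt0// -ler_expR lnK ?posrE ?ltr0n//.
apply: (@le_trans _ _ (Num.truncn x).+1%:R); last by rewrite ler_nat.
by rewrite ltW// -truncn_le_nat.
Qed.

Lemma cvg_reach_shift (j : int) :
  (reach R (n m) `|L m + j|)%:E @[m --> \oo] -->
  P [set t | (S_infty Y t <= expR ((eta - j%:~R) * ln 2))%R].
Proof.
apply: cvg_reach => //.
- apply/cvgnyPge => A.
  apply: filterS (near_floor_log2_ge (A%:Z - j)) => m; rewrite /= lerBlDr => AL.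
  by rewrite -lez_nat (le_trans AL)// lez_abs.
have : expR ((frac_part (log2 ((n m)%:R : R)) - j%:~R) * ln 2) @[m --> \oo] -->
    expR ((eta - j%:~R) * ln 2).
  apply: continuous_cvg; first exact: continuous_expR.
  by apply: cvgMr_tmp; apply: cvgB => //; exact: cvg_cst.
apply: cvg_trans; apply: near_eq_cvg.
apply: filterS (near_floor_log2_ge (- j)) => m.
rewrite -subr_ge0 opprK => Lj.
rewrite /frac_part -/(L m).
have -> : log2 (n m)%:R - (L m)%:~R - j%:~R = log2 ((n m)%:R : R) - (absz (L m + j))%:R.
  by rewrite natr_absz ger0_norm// intrD; ring.
rewrite mulrBl expRB /log2 divfK ?gt_eqF ?ln2_gt0// lnK ?posrE ?ltr0n//.
by rewrite expRM_natl lnK// posrE.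
Qed.

End limit_law.

Unset Implicit Arguments.
Set Strict Implicit.

Theorem mainTheorem3 (R : realType)
    (d : measure_display) (T : measurableType d) (P : probability T R)
    (U : nat -> {RV P >-> R})
    (d' : measure_display) (T' : measurableType d') (P' : probability T' R)
    (Y : nat -> {RV P' >-> R})
    (theta : nat -> bool) (n : nat -> nat) (eta : R) :
  mutually_independent U ->
  (forall i, has_law (U i) (uniform_prob (@ltr01 R))) ->
  mutually_independent Y ->
  (forall k, has_law (Y k) (exponential_prob 2)) ->
  0 <= eta <= 1 ->
  (forall m, (0 < n m)%N) ->
  n @ \oo --> \oo ->
  frac_part (log2 ((n m)%:R : R)) @[m --> \oo] --> eta ->
  weakly_converges
    (fun m => distribution P (centered_free_depth U theta (n m)))
    (distribution P' (limit_depth Y eta)).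
Proof.
move=> iU lawU iY lawY _ n0 noo neta.
pose L m : int := Num.floor (log2 ((n m)%:R : R)).
apply: weakly_converges_mass; last exact: limit_depth_int.
move=> j.
rewrite [X in _ --> X](prob_limit_depth iY lawY).
pose K m := absz (L m + j).
have mass : \forall m \near \oo,
    (distribution P (centered_free_depth U theta (n m)) [set j%:~R] =
     (reach R (n m) (K m))%:E - (reach R (n m) (K m).+1)%:E)%E.
  apply: filterS (@near_floor_log2_ge R n n0 noo (- j)) => m.
  rewrite -subr_ge0 opprK => Lj.
  have KE : (K m)%:R = (L m)%:~R + j%:~R :> R.
    by rewrite natr_absz ger0_norm// intrD.
  rewrite -!(prob_le_free_depth theta iU lawU) /distribution/= /pushforward.
  have mE k : measurable [set x | (k <= free_depth U theta (n m) x)%N].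
    by have [] := indep_event_free_depth theta iU lawU (n m) k.
  rewrite -[X in (_ - P X)%E](@setIidr _ [set x | (K m <= free_depth U theta (n m) x)%N]).
    rewrite -measureD//; last by rewrite ltey_eq fin_num_measure.
    congr (P _); apply/seteqP; split => x;
        rewrite /preimage/= /centered_free_depth -/(L m).
      move=> /eqP; rewrite subr_eq addrC -KE eqr_nat => /eqP ->.
      by rewrite leqnn ltnn.
    move=> [Kx /negP]; rewrite -leqNgt => xK.
    have -> : free_depth U theta (n m) x = K m.
      by apply/eqP; rewrite eqn_leq xK.
    by rewrite KE addrAC subrr add0r.
  by move=> x /=; apply: ltnW.
apply: (cvg_trans (near_eq_cvg (filterS (fun _ => @esym _ _ _) mass))).
apply: cvgeB.
- apply: fin_num_adde_defr; rewrite fin_num_measure//.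
  exact: (measurable_funPTI (S_infty Y) (measurable_itv `]-oo, _])).
- exact: cvg_reach_shift.
have := cvg_reach_shift (j := j + 1) iY lawY n0 noo neta.
apply: cvg_trans; apply: near_eq_cvg.
apply: filterS (@near_floor_log2_ge R n n0 noo (- j)) => m.
rewrite -subr_ge0 opprK => Lj.
rewrite /K addrA; case: (L m + j) Lj => // k _.
by rewrite /= addn1.
Qed.
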